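(* Let an $s$-stage implicit Peer method $w_n = P w_{n-1} + \triangle t\, R F(w_n)$ with coefficients $(c,P,R)$ be given, where $c=(c_1,\ldots,c_s)^T\in\mathbb{R}^s$ has pairwise distinct entries with $c_s=1$, $P\in\mathbb{R}^{s\times s}$, and $R\in\mathbb{R}^{s\times s}$ is lower triangular. Let the method be zero-stable and suppose its stage order is equal to $s$. Let $S_2\in\mathbb{R}^{s\times s}$ be an arbitrary strictly lower triangular matrix and put $$\hat R = R S_2,\qquad \hat Q = R(I-S_2)V_0V_1^{-1},$$ where $V_0=(c_i^{j-1})_{i,j=1}^s$ and $V_1=((c_i-1)^{j-1})_{i,j=1}^s$. Consider, for a non-stiff problem $u'(t)=F_0(u(t))+F_1(u(t))$, $u(0)=u_0\in\mathbb{R}^m$, the implicit-explicit (IMEX) Peer scheme $$w_n = P w_{n-1} + \triangle t\,\hat Q F_0(w_{n-1}) + \triangle t\,\hat R F_0(w_n) + \triangle t\, R F_1(w_n),\qquad n\ge 1.$$ Let the starting values satisfy $w_{0,i}-u(t_0+c_i\triangle t)=\mathcal{O}(\triangle t^s)$ for $i=1,\ldots,s$. Then the IMEX scheme is convergent of order $s$ for constant step size $\triangle t$ and arbitrary strictly lower triangular matrix $S_2$.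
   Context: Notation. $t_n=n\triangle t$ (so $t_0=0$), $w_n=[w_{n,1},\ldots,w_{n,s}]^T\in(\mathbb{R}^m)^s$ with $w_{n,i}\approx u(t_n+c_i\triangle t)$. For $w\in(\mathbb{R}^m)^s$ and $F:\mathbb{R}^m\to\mathbb{R}^m$, $F(w)=[F(w_i)]_{i=1}^s$ is componentwise application; the implicit Peer method is a method for $u'(t)=F(u(t))$. An $s\times s$ matrix $A$ acts on $(\mathbb{R}^m)^s$ as $A\otimes I_m$, with $I_m$ the $m\times m$ identity matrix; $I$ is the $s\times s$ identity matrix. The convention $x^0=1$ (including $0^0=1$) is used. Let $e=(1,\ldots,1)^T\in\mathbb{R}^s$, and let powers of vectors be taken entrywise, $c^j=(c_1^j,\ldots,c_s^j)^T$. Zero-stability of the implicit method: $P$ has spectral radius $1$ and the eigenvalues of $P$ of modulus $1$ are not defective. Stage order: the implicit method $(c,P,R)$ has stage order $q$ if $Pe=e$ and $d_j=0$ for $j=1,\ldots,q$, where $$d_j=\frac{1}{j!}\left(c^j-P(c-e)^j-jRc^{j-1}\right).$$ Non-stiff problem: the term is used in the customary sense of classical convergence theory for ordinary differential equations; that is, the exact solution $u$ and the function $t\mapsto F_0(u(t))$ are as smooth as the Taylor expansions of the local errors require, and the constants in the error bounds are allowed to depend on the problem, in particular on Lipschitz constants of $F_0$ and $F_1$; no bounds uniform with respect to stiffness are claimed. Convergent of order $s$: the global errors satisfy $w_{n,i}-u(t_n+c_i\triangle t)=\mathcal{O}(\triangle t^s)$ as $\triangle t\to0$, for $i=1,\ldots,s$,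 uniformly for $t_n$ in bounded time intervals on which the solution is considered. *)

(* Defs.v *)
From HB Require Import structures.
From mathcomp Require Import all_boot all_order all_algebra.
From mathcomp Require Import complex.
From mathcomp Require Import all_classical all_reals all_analysis.

Set Implicit Arguments.
Unset Strict Implicit.
Unset Printing Implicit Defensive.

Import Order.TTheory GRing.Theory Num.Theory.
Import numFieldNormedType.Exports.

Local Open Scope classical_set_scope.
Local Open Scope ring_scope.

(* A stage vector w = (w_1, ..., w_s) in (K^m)^s is the s x m matrix with rows
   w_i, so that [A *m w] is the action of A (x) I_m.  Stage indices are 0-based:
   the last stage c_s is the entry whose index i satisfies i.+1 = s. *)

Section Peer.
Variable K : realType.

(** * Coefficients of a Peer method *)

Definition complex_mx (s : nat) (P : 'M[K]_s) : 'M[complex K]_s :=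
  map_mx (real_complex K) P.

Definition spectral_radius (s : nat) (P : 'M[K]_s) : K :=
  sup [set Normc.normc z | z in [set z | eigenvalue (complex_mx P) z]].

(* Geometric multiplicity smaller than algebraic multiplicity.  The library's
   eigenspaces consist of row eigenvectors; their dimension is the same as for
   column eigenvectors. *)
Definition defective (s : nat) (A : 'M[complex K]_s) (z : complex K) : Prop :=
  (\rank (eigenspace A z) < mup z (char_poly A))%N.

Definition zero_stable (s : nat) (P : 'M[K]_s) : Prop :=
  spectral_radius P = 1 /\
  forall z : complex K, eigenvalue (complex_mx P) z -> Normc.normc z = 1 ->
    ~ defective (complex_mx P) z.

Definition ones (s : nat) : 'cV[K]_s := const_mx 1.

Definition powv (s : nat) (c : 'cV[K]_s) (j : nat) : 'cV[K]_s :=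
  map_mx (fun x => x ^+ j) c.

Definition stage_defect (s : nat) (c : 'cV[K]_s) (P R : 'M[K]_s) (j : nat) :
    'cV[K]_s :=
  (j`!%:R)^-1 *:
    (powv c j - P *m powv (c - ones s) j - j%:R *: (R *m powv c j.-1)).

Definition has_stage_order (s : nat) (c : 'cV[K]_s) (P R : 'M[K]_s)
    (q : nat) : Prop :=
  P *m ones s = ones s /\
  forall j : nat, (1 <= j <= q)%N -> stage_defect c P R j = 0.

Definition strictly_lower (s : nat) (A : 'M[K]_s) : Prop :=
  forall i j : 'I_s, (i <= j)%N -> A i j = 0.

(* Row i holds the powers of c_i: the transpose of the library's convention. *)
Definition vander (s : nat) (c : 'cV[K]_s) : 'M[K]_s := (Vandermonde s c^T)^T.

Definition Rhat (s : nat) (R S2 : 'M[K]_s) : 'M[K]_s := R *m S2.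

Definition Qhat (s : nat) (c : 'cV[K]_s) (R S2 : 'M[K]_s) : 'M[K]_s :=
  R *m (1%:M - S2) *m vander c *m invmx (vander (c - ones s)).

(** * The initial value problem *)

Definition C_on (V : normedModType K) (k : nat) (a b : K) (f : K -> V) : Prop :=
  exists g : nat -> K -> V,
  [/\ g 0%N = f,
      forall j, (j <= k)%N -> {within `[a, b], continuous (g j)} &
      forall j t, (j < k)%N -> t \in `]a, b[ ->
        is_derive t (1 : K) (g j) (g j.+1 t)].

(* The exact solution on [a, b] of a non-stiff problem.  F0 and F1 satisfy a
   Lipschitz condition on a neighbourhood D of the solution curve; D = setT is
   the case of globally Lipschitz F0, F1.  An interval with a < 0 is needed
   when some node c_i is negative. *)
Definition nonstiff_solution (m : nat) (F0 F1 : 'rV[K]_m -> 'rV[K]_m)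
    (D : set 'rV[K]_m) (s : nat) (a b : K) (u0 : 'rV[K]_m)
    (u : K -> 'rV[K]_m) : Prop :=
  [/\ [lipschitz F0 x | x in D], [lipschitz F1 x | x in D],
      forall t, t \in `[a, b] -> nbhs (u t) D,
      u 0 = u0 /\
      (forall t, t \in `]a, b[ -> is_derive t (1 : K) u (F0 (u t) + F1 (u t))) &
      C_on s.+1 a b u /\ C_on s a b (F0 \o u)].

(** * The IMEX Peer scheme *)

Definition appF (s m : nat) (F : 'rV[K]_m -> 'rV[K]_m) (w : 'M[K]_(s, m)) :
    'M[K]_(s, m) :=
  \matrix_(i < s) F (row i w).

Definition imex_step (s m : nat) (P Q0 R0 R : 'M[K]_s)
    (F0 F1 : 'rV[K]_m -> 'rV[K]_m) (h : K) (w w' : 'M[K]_(s, m)) : Prop :=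
  w' = P *m w + h *: (Q0 *m appF F0 w) + h *: (R0 *m appF F0 w')
         + h *: (R *m appF F1 w').

(* N steps with starting value w0, the stages staying in D. *)
Definition imex_run (s m : nat) (P Q0 R0 R : 'M[K]_s)
    (F0 F1 : 'rV[K]_m -> 'rV[K]_m) (D : set 'rV[K]_m) (h : K) (N : nat)
    (w0 : 'M[K]_(s, m)) (w : nat -> 'M[K]_(s, m)) : Prop :=
  [/\ w 0%N = w0,
      forall n, (1 <= n <= N)%N ->
        imex_step P Q0 R0 R F0 F1 h (w n.-1) (w n) &
      forall n i, (n <= N)%N -> D (row i (w n))].

Definition stage_time (s : nat) (c : 'cV[K]_s) (h : K) (n : nat) (i : 'I_s) : K :=
  n%:R * h + c i 0 * h.

(* w0 h is the starting value used with step size h.  The implicit equations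
   determine w only in conjunction with D, so the notion has two parts: for all
   small h the scheme has a numerical solution in D as long as the stage times
   lie in [a, b], and every such solution has a global error bounded by
   C h^p with C independent of h and n. *)
Definition imex_convergent (s m : nat) (c : 'cV[K]_s) (P Q0 R0 R : 'M[K]_s)
    (F0 F1 : 'rV[K]_m -> 'rV[K]_m) (D : set 'rV[K]_m) (a b : K)
    (u : K -> 'rV[K]_m) (w0 : K -> 'M[K]_(s, m)) (p : nat) : Prop :=
  exists C : K, \forall h \near 0^'+, forall N : nat,
    (forall n i, (n <= N)%N -> stage_time c h n i \in `[a, b]) ->
    (exists w, imex_run P Q0 R0 R F0 F1 D h N (w0 h) w) /\
    (forall w, imex_run P Q0 R0 R F0 F1 D h N (w0 h) w ->
       forall n i, (n <= N)%N ->
         `|row i (w n) - u (stage_time c h n i)| <= C * h ^+ p).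

End Peer.

(* Main.v *)
Require Import Defs.
From HB Require Import structures.
From mathcomp Require Import all_boot all_order all_algebra.
From mathcomp Require Import complex.
From mathcomp Require Import all_classical all_reals all_analysis.
From mathcomp Require Import ring lra.

(** Write [U_n] for the stage vector of the exact solution at step [n], [h] for
    the step size and [e_n = w_n - U_n].  As usual, convergence is consistency
    plus stability, here together with solvability of the implicit equations.

    Consistency.  The matrix [V0 V1^-1] sends the values of a polynomial of
    degree less than [s] at the old nodes [c_i - 1] to its values at the new
    nodes [c_i].  So [V0 V1^-1 F0(U_(n-1))] predicts
    [F0(U_n)] up to [O(h^s)], and inserting [U_n] in the IMEX scheme leaves
    - the residual of the implicit method for [u' = F0(u) + F1(u)], whose Taylor
      expansion at [t_n] vanishes up to order [s] by the order conditions
      ([taylor_stages_stage_order]), and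
    - [h R (I - S2)] times the extrapolation error
      ([taylor_stages_extrapolation]).
    Both are [O(h^(s+1))] for every [S2] ([local_error], [imex_consistency]).

    Stability.  Zero-stability means that the powers of [P] are bounded
    ([zero_stable_power_bounded]).  A peripheral eigenvalue that is not
    defective is a simple root of the minimal polynomial ([mup_mxminpoly_le1]),
    and each entry of [P^k] satisfies the linear recurrence of that polynomial.
    Roots inside the unit disc can be divided out of a recurrence without
    losing summability, and the remaining roots, on the circle and distinct,
    leave a bounded sequence ([power_bounded]).  No Jordan form is involved.
    Solving the recursion [e_n = P e_(n-1) + r_(n-1)] and applying the discrete
    Gronwall inequality then bounds [e_n] by a multiple of the initial error
    plus the accumulated local errors, which is [O(h^s)] ([stability]).

    Solvability.  By compactness the solution curve has a tube of uniform radius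
    inside [D] ([tube]).  As long as [w_n] is [O(h^s)]-close to [U_n], one step
    of the scheme is a contraction of the tube's ball around [U_(n+1)] for small
    [h] ([imex_step_exists]); the error bound applied to the run constructed so
    far shows that this closeness never gets lost. *)

Set Implicit Arguments.
Unset Strict Implicit.
Unset Printing Implicit Defensive.

Import Order.TTheory GRing.Theory Num.Theory.
Import numFieldNormedType.Exports.

Local Open Scope classical_set_scope.
Local Open Scope ring_scope.

(** * Semisimple eigenvalues are simple roots of the minimal polynomial *)

Lemma char_poly_similar (F : fieldType) (n : nat) (B A C : 'M[F]_n) :
  B \in unitmx -> B *m A = C *m B -> char_poly A = char_poly C.
Proof.
rewrite unitmxE unitfE => detB0 BA.
have BX : map_mx polyC B *m char_poly_mx A = char_poly_mx C *m map_mx polyC B.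
  by rewrite mulmxBr mulmxBl scalar_mxC -!map_mxM BA.
move/(congr1 determinant): BX; rewrite !det_mulmx mulrC.
by move/mulIf; apply; rewrite det_map_mx polyC_eq0.
Qed.

Lemma char_poly_lblock (F : fieldType) (g k : nat) (a : F) (L : 'M[F]_(k, g))
    (D : 'M[F]_k) :
  char_poly (block_mx a%:M 0 L D) = ('X - a%:P) ^+ g * char_poly D.
Proof.
rewrite /char_poly /char_poly_mx map_block_mx raddf0 map_scalar_mx /=.
rewrite scalar_mx_block opp_block_mx add_block_mx oppr0 addr0 det_lblock.
by rewrite -raddfB det_scalar.
Qed.

Lemma horner_mx_lblock (F : fieldType) (g k : nat) (a : F)
    (L : 'M[F]_(k.+1, g.+1)) (D : 'M[F]_k.+1) (p : {poly F}) :
  exists L' : 'M[F]_(k.+1, g.+1),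
    horner_mx (block_mx a%:M 0 L D : 'M[F]_(g.+1 + k.+1)) p =
    block_mx (p.[a])%:M 0 L' (horner_mx D p) :> 'M[F]_(g.+1 + k.+1).
Proof.
elim/poly_ind: p => [|p c [L' IH]].
  by exists 0; rewrite !rmorph0 horner0 raddf0 block_mx_const.
exists (L' *m a%:M + horner_mx D p *m L).
rewrite !rmorphD !rmorphM /= !horner_mx_X !horner_mx_C IH.
have mulE (X Y : 'M[F]_((g + k.+1).+1)) :
  X * Y = (X : 'M[F]_(g.+1 + k.+1)) *m (Y : 'M[F]_(g.+1 + k.+1)) by [].
have addE (X Y : 'M[F]_((g + k.+1).+1)) :
  X + Y = (X : 'M[F]_(g.+1 + k.+1)) + (Y : 'M[F]_(g.+1 + k.+1)) by [].
rewrite addE mulE mulmx_block.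
rewrite !mul0mx !mulmx0 !addr0 !add0r -scalar_mxM.
have -> : c%:M = block_mx c%:M 0 0 c%:M :> 'M[F]_(g.+1 + k.+1).
  exact: scalar_mx_block.
by rewrite add_block_mx !addr0 -raddfD hornerMXaddC.
Qed.

(** In a basis that starts with a basis of the eigenspace, [A] becomes block
    lower triangular with the scalar block [a%:M] in the upper left corner.  Take
    for [r] the characteristic polynomial of the other diagonal block: it kills
    that block, so the rows of [r(A)] lie in the eigenspace. *)
Lemma annihilator_of_eigenspace (F : fieldType) (n : nat) (A : 'M[F]_n.+1)
    (a : F) :
  exists r : {poly F},
    char_poly A = ('X - a%:P) ^+ \rank (eigenspace A a) * r /\
    horner_mx A (r * ('X - a%:P)) = 0.
Proof.
move rk_g : (\rank (eigenspace A a)) => g.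
case: (posnP g) => [->|g_gt0].
  by exists (char_poly A); rewrite mul1r rmorphM /= Cayley_Hamilton mul0r.
have [gn|gn] := leqP n.+1 g.
  have : row_full (eigenspace A a).
    by rewrite /row_full rk_g eqn_leq gn -{1}rk_g rank_leq_row.
  rewrite -sub1mx => /eigenspaceP; rewrite mul1mx scalemx1 => ->.
  have -> : g = n.+1 by apply/eqP; rewrite eqn_leq gn -{1}rk_g rank_leq_row.
  exists 1; rewrite mulr1 mul1r rmorphB /= horner_mx_X horner_mx_C subrr.
  by split=> //; rewrite /char_poly /char_poly_mx map_scalar_mx -raddfB det_scalar.
have [[k g'] [/= nE gE]] : exists kg : nat * nat, n = (kg.2 + kg.1.+1)%N /\ g = kg.2.+1.
  exists ((n - g)%N, g.-1); rewrite /= prednK//; split=> //.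
  by rewrite addnS -addSn prednK// subnKC.
subst n; move: rk_g; rewrite {}gE => rk_g {g g_gt0 gn}.
set E := eigenspace A a in rk_g.
pose B := row_ebase E.
have Bu : B \in unitmx by exact: row_ebase_unit.
pose C : 'M[F]_(g'.+1 + k.+1) := B *m A *m invmx B.
have BM : B *m A = C *m B by rewrite mulmxKV.
have pidC : (pid_mx g'.+1 : 'M[F]_(g'.+1 + k.+1)) *m C = a *: pid_mx g'.+1.
  have pidB : (pid_mx g'.+1 : 'M[F]_(g'.+1 + k.+1)) *m B = invmx (col_ebase E) *m E.
    have EE := mulmx_ebase E; rewrite rk_g in EE.
    by rewrite -{2}EE -!mulmxA mulKmx ?col_ebase_unit.
  have EA : E *m A = a *: E by apply/eigenspaceP.
  rewrite /C !mulmxA pidB -(mulmxA _ E) EA.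
  by rewrite -scalemxAr -pidB -scalemxAl mulmxK.
have CE : C = block_mx a%:M 0 (dlsubmx C) (drsubmx C).
  move: pidC; rewrite -[in X in X -> _](submxK C) pid_mx_block mulmx_block.
  rewrite !mul1mx !mul0mx !addr0 scale_block_mx !scaler0.
  move/eq_block_mx => [ul ur _ _].
  by rewrite -[LHS]submxK ul ur scalemx1.
exists (char_poly (drsubmx C)); split.
  rewrite (char_poly_similar Bu BM).
  have := char_poly_lblock a (dlsubmx C) (drsubmx C); rewrite -CE.
  by move=> ->.
have [L' hC] := horner_mx_lblock a (dlsubmx C) (drsubmx C) (char_poly (drsubmx C)).
have CaE : C - a%:M = block_mx 0 0 (dlsubmx C) (drsubmx C - a%:M)
    :> 'M[F]_(g'.+1 + k.+1).
  rewrite {1}CE scalar_mx_block opp_block_mx add_block_mx !subrr.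
  by rewrite !subr0.
have C0 : horner_mx C (char_poly (drsubmx C) * ('X - a%:P)) = 0.
  rewrite rmorphM rmorphB /= horner_mx_X horner_mx_C.
  rewrite [LHS](_ : _ = horner_mx C (char_poly (drsubmx C)) *m (C - a%:M))//.
  rewrite CaE {1}CE hC Cayley_Hamilton.
  apply: etrans (@mulmx_block F g'.+1 k.+1 g'.+1 k.+1 g'.+1 k.+1 _ _ _ _ _ _ _ _) _.
  by rewrite !mulmx0 !mul0mx !addr0 block_mx_const.
have AE : A = invmx B *m C *m B by rewrite /C !mulmxA mulVmx// mul1mx mulmxKV.
by rewrite AE horner_mx_uconjC// C0 mulmx0 mul0mx.
Qed.

(** The algebraic multiplicity of [a] being used up by the factor
    [('X - a%:P) ^+ \rank (eigenspace A a)], the cofactor [r] of the previous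
    lemma does not vanish at [a], while [r * ('X - a%:P)] annihilates [A]. *)
Lemma mup_mxminpoly_le1 (F : fieldType) (n : nat) (A : 'M[F]_n.+1) (a : F) :
  (mup a (char_poly A) <= \rank (eigenspace A a))%N ->
  (mup a (mxminpoly A) <= 1)%N.
Proof.
move=> le_mup; have [r [chi ann]] := annihilator_of_eigenspace A a.
have chi0 : char_poly A != 0 by rewrite monic_neq0 ?char_poly_monic.
have r0 : r != 0 by apply: contra_neq chi0 => r0; rewrite chi r0 mulr0.
have X0 : 'X - a%:P != 0 :> {poly F} by rewrite polyXsubC_eq0.
have mup_r : mup a r = 0%N.
  move: le_mup; rewrite {1}chi mupM ?expf_neq0// mup_XsubCX eqxx.
  by rewrite -[leqRHS]addn0 leq_add2l leqn0 => /eqP.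
have min0 : mxminpoly A != 0 by rewrite monic_neq0 ?mxminpoly_monic.
rewrite (@leq_trans (mup a (r * ('X - a%:P))))//; last first.
  by rewrite mupM// mup_r -['X - _]expr1 mup_XsubCX eqxx.
rewrite mup_geq ?mulf_neq0// (dvdp_trans _ (mxminpoly_min ann))//.
by rewrite -mup_geq.
Qed.

(** * Scalar linear recurrences with roots in the unit disc *)

(** The operator [S - l], where [S] is the shift.  A sequence satisfies the
    linear recurrence with characteristic roots [s] when the composition of these
    operators over [s] kills it. *)
Definition shift_sub (C : numFieldType) (l : C) (x : nat -> C) : nat -> C :=
  fun n => x n.+1 - l * x n.

Definition summable_seq (C : numFieldType) (x : nat -> C) : Prop :=
  exists M : C, forall n, \sum_(k < n) `|x k| <= M.

Definition bounded_seq (C : numFieldType) (x : nat -> C) : Prop :=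
  exists M : C, forall n, `|x n| <= M.

Lemma shift_subC (C : numFieldType) (l k : C) (x : nat -> C) :
  shift_sub l (shift_sub k x) = shift_sub k (shift_sub l x).
Proof.
by apply: funext => n; rewrite /shift_sub; ring.
Qed.

Lemma foldr_shift_subC (C : numFieldType) (l : C) (s : seq C) (x : nat -> C) :
  foldr (@shift_sub C) (shift_sub l x) s = shift_sub l (foldr (@shift_sub C) x s).
Proof. by elim: s => //= k s ->; rewrite shift_subC. Qed.

(** Summing [`|x (k + 1)| <= `|l| * `|x k| + `|(S - l) x k|] over [k] bounds
    [1 - `|l|] times the partial sums of [`|x|]. *)
Lemma summable_shift_sub (C : numFieldType) (l : C) (x : nat -> C) :
  `|l| < 1 -> summable_seq (shift_sub l x) -> summable_seq x.
Proof.
move=> l1 [M leM]; exists ((`|x 0%N| + M) / (1 - `|l|)) => n.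
rewrite ler_pdivlMr ?subr_gt0// mulrBr mulr1 lerBlDr.
apply: (@le_trans _ _ (\sum_(k < n.+1) `|x k|)).
  by rewrite big_ord_recr /= lerDl.
rewrite big_ord_recl /= -addrA lerD2l mulrC mulr_sumr.
apply: le_trans (lerD (leM n) (lexx _)); rewrite -big_split /=.
apply: ler_sum => k _; rewrite /bump /= add1n -normrM.
by rewrite (le_trans _ (ler_normD _ _))// /shift_sub subrK.
Qed.

Lemma bounded_shift_sub (C : numFieldType) (l : C) (x : nat -> C) :
  `|l| <= 1 -> summable_seq (shift_sub l x) -> bounded_seq x.
Proof.
move=> l1 [M leM]; exists (`|x 0%N| + M) => n.
apply: le_trans (lerD (lexx _) (leM n)).
elim: n => [|n IH]; first by rewrite big_ord0 addr0.
rewrite big_ord_recr /= -[x n.+1](subrK (l * x n)).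
rewrite (le_trans (ler_normD _ _))// addrA [leRHS]addrC lerD//.
by rewrite (le_trans _ IH)// normrM ler_piMl.
Qed.

Lemma summable_foldr_shift_sub (C : numFieldType) (s : seq C) (x : nat -> C) :
  (forall l, l \in s -> `|l| < 1) ->
  summable_seq (foldr (@shift_sub C) x s) -> summable_seq x.
Proof.
elim: s => //= l s IH ls1 /summable_shift_sub lx.
apply: IH => [k ks|]; first by rewrite ls1// inE ks orbT.
by apply: lx; rewrite ls1// inE eqxx.
Qed.

(** For two of the roots, [a] and [b], the sequences [(S - a) x] and [(S - b) x]
    are bounded by induction, and their difference is [(b - a) x]. *)
Lemma bounded_foldr_shift_sub (C : numFieldType) (s : seq C) (x : nat -> C) :
  uniq s -> (forall l, l \in s -> `|l| <= 1) -> (0 < size s)%N ->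
  summable_seq (foldr (@shift_sub C) x s) -> bounded_seq x.
Proof.
move sz: (size s) => n; elim: n s sz x => // -[|n] IH [|a s] //= [sz] x.
  by move/size0nil: sz => -> _ ls1 _ /=; apply: bounded_shift_sub; rewrite ls1 ?inE.
case: s sz => // b s sz /=.
rewrite inE negb_or => /andP[/andP[ab nas] /andP[nbs us]] ls1 _ sm.
have [] := IH (b :: s) sz (shift_sub a x) _ _ isT.
- by rewrite /= nbs.
- by move=> l lbs; rewrite ls1// inE lbs orbT.
- by rewrite foldr_shift_subC.
move=> Ma leMa; have [] := IH (a :: s) sz (shift_sub b x) _ _ isT.
- by rewrite /= nas.
- by move=> l; rewrite inE => /orP[/eqP->|las]; rewrite ls1// !inE ?eqxx// las !orbT.
- by rewrite foldr_shift_subC /= shift_subC.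
move=> Mb leMb; exists ((Ma + Mb) / `|b - a|) => n0.
rewrite ler_pdivlMr ?normr_gt0 ?subr_eq0 1?eq_sym// -normrM.
have -> : x n0 * (b - a) = shift_sub a x n0 - shift_sub b x n0.
  by rewrite /shift_sub; ring.
by rewrite (le_trans (ler_normB _ _))// lerD.
Qed.

(** On the powers of [A] the shift is multiplication by [A]. *)
Lemma foldr_shift_sub_pow (C : numFieldType) (n : nat) (A : 'M[C]_n.+1)
    (s : seq C) (i j : 'I_n.+1) (k : nat) :
  foldr (@shift_sub C) (fun k => (A ^+ k) i j) s k =
  (A ^+ k * horner_mx A (\prod_(z <- s) ('X - z%:P))) i j.
Proof.
elim: s k => [|z s IH] k; first by rewrite big_nil rmorph1 mulr1.
rewrite /= /shift_sub !IH big_cons rmorphM rmorphB /= horner_mx_X horner_mx_C.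
rewrite mulrBl mulrBr mulrA -exprSr.
rewrite [z%:M * _]mul_scalar_mx -scalerAr.
by rewrite !mxE.
Qed.

(** The recurrence is the one of the minimal polynomial.  Its roots inside the
    unit disc, of any multiplicity, are removed first and keep the sequence of
    residuals summable; those on the circle are distinct. *)
Lemma power_bounded (C : numClosedFieldType) (n : nat) (A : 'M[C]_n.+1) :
  (forall z, eigenvalue A z -> `|z| <= 1) ->
  (forall z, eigenvalue A z -> `|z| = 1 ->
    (mup z (char_poly A) <= \rank (eigenspace A z))%N) ->
  forall i j, bounded_seq (fun k => (A ^+ k) i j).
Proof.
move=> ev1 nondef i j; set x := fun k => _.
have [rs] := closed_field_poly_normal (mxminpoly A).
rewrite (monicP (mxminpoly_monic A)) scale1r => minE.
have rs_ev z : z \in rs -> eigenvalue A z.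
  by rewrite eigenvalue_root_min minE root_prod_XsubC.
pose inner := [pred z : C | `|z| < 1].
(* With the roots of the circle innermost, those inside the disc come off first. *)
have rsE : perm_eq rs (seq.filter inner rs ++ seq.filter (predC inner) rs).
  by rewrite perm_sym perm_filterC.
have : summable_seq (foldr (@shift_sub C) x
    (seq.filter inner rs ++ seq.filter (predC inner) rs)).
  exists 0 => N; rewrite big1// => k _; rewrite foldr_shift_sub_pow.
  by rewrite -(perm_big _ rsE) /= -minE mx_root_minpoly mulr0 mxE normr0.
rewrite foldr_cat => /summable_foldr_shift_sub sm.
have {sm} /sm : forall l, l \in seq.filter inner rs -> `|l| < 1.
  by move=> l; rewrite mem_filter => /andP[].
have [s0|s0] := posnP (size (seq.filter (predC inner) rs)).
  rewrite (size0nil s0) /= => -[M leM]; exists M => k.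
  rewrite (le_trans _ (leM k.+1))// big_ord_recr /= lerDr.
  exact: sumr_ge0.
apply: bounded_foldr_shift_sub => //.
- apply: count_mem_uniq => z.
  have [zP|] := boolP (z \in seq.filter (predC inner) rs); last by move/count_memPn.
  move: (zP); rewrite mem_filter => /andP[/= z_out /rs_ev z_ev].
  have z1 : `|z| = 1.
    by apply/eqP; rewrite eq_le ev1// real_leNgt ?num_real.
  apply/eqP; rewrite eqn_leq -has_count has_pred1 zP andbT count_filter.
  rewrite (leq_trans _ (mup_mxminpoly_le1 (nondef _ z_ev z1)))//.
  rewrite minE mu_prod_XsubC; apply: sub_count => y /=.
  by case/andP.
- by move=> l; rewrite mem_filter => /andP[_ /rs_ev/ev1].
Qed.

(** * The maximum norm of matrices *)

Lemma mx_norm_le (K : realType) (m n : nat) (A : 'M[K]_(m, n)) (M : K) :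
  0 <= M -> (forall i j, `|A i j| <= M) -> `|A| <= M.
Proof.
by move=> M0 leM; rewrite /Num.norm /= mx_normrE; apply: bigmax_le.
Qed.

Lemma entry_le_mx_norm (K : realType) (m n : nat) (A : 'M[K]_(m, n)) i j :
  `|A i j| <= `|A|.
Proof.
rewrite [leRHS]/Num.norm /= mx_normrE.
exact: (le_bigmax _ (fun ij : 'I_m * 'I_n => `|A ij.1 ij.2|) (i, j)).
Qed.

Lemma mx_norm_mul (K : realType) (m n p : nat) (A : 'M[K]_(m, n))
    (B : 'M[K]_(n, p)) :
  `|A *m B| <= n%:R * `|A| * `|B|.
Proof.
apply: mx_norm_le => [|i j]; first by rewrite !mulr_ge0.
rewrite mxE (le_trans (ler_norm_sum _ _ _))//.
rewrite (@le_trans _ _ (\sum_(k < n) `|A| * `|B|))//; last first.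
  by rewrite sumr_const card_ord -mulrA mulr_natl.
by apply: ler_sum => k _; rewrite normrM ler_pM ?entry_le_mx_norm.
Qed.

Lemma row_le_mx_norm (K : realType) (m n : nat) (A : 'M[K]_(m, n)) i :
  `|row i A| <= `|A|.
Proof. by apply: mx_norm_le => // k j; rewrite mxE entry_le_mx_norm. Qed.

Lemma mx_norm_le_rows (K : realType) (m n : nat) (A : 'M[K]_(m, n)) (M : K) :
  0 <= M -> (forall i, `|row i A| <= M) -> `|A| <= M.
Proof.
move=> M0 leM; apply: mx_norm_le => // i j; apply: le_trans (leM i).
by have := entry_le_mx_norm (row i A) 0 j; rewrite mxE.
Qed.

(** * Zero-stability and bounded powers *)

(** The supremum of a set that has none is [0] by convention, so a spectral
    radius equal to [1] does bound all the eigenvalues. *)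
Lemma zero_stable_power_bounded (K : realType) (n : nat) (P : 'M[K]_n.+1) :
  zero_stable P -> exists2 M : K, 0 <= M & forall k, `|P ^+ k| <= M.
Proof.
move=> [rho1 nondef].
have normcE (z : complex K) : `|z| = real_complex K (Normc.normc z) by [].
have ev1 z : eigenvalue (complex_mx P) z -> `|z| <= 1.
  move=> z_ev; rewrite normcE (_ : 1 = real_complex K 1)// lecR -rho1.
  have /sup_upper_bound/ubP ub : has_sup
      [set Normc.normc z | z in [set z | eigenvalue (complex_mx P) z]].
    have [//|/sup_out] := pselect (has_sup
      [set Normc.normc z | z in [set z | eigenvalue (complex_mx P) z]]).
    by move: rho1; rewrite /spectral_radius => -> /eqP; rewrite oner_eq0.
  by apply: ub; exists z.
have nondef' z : eigenvalue (complex_mx P) z -> `|z| = 1 ->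
    (mup z (char_poly (complex_mx P)) <= \rank (eigenspace (complex_mx P) z))%N.
  move=> z_ev; rewrite normcE => -[z1]; rewrite leqNgt; apply/negP.
  exact: nondef.
have bd i j : exists M : K, forall k, `|(P ^+ k) i j| <= M.
  have [M leM] := power_bounded ev1 nondef' i j.
  exists (complex.Re M) => k; have := leM k.
  have -> : (complex_mx P ^+ k) i j = real_complex K ((P ^+ k) i j).
    by rewrite /complex_mx -rmorphXn mxE.
  by rewrite normcE lecE => /andP[_]; rewrite /= expr0n /= addr0 sqrtr_sqr.
have /choice[f fP] : forall ij : 'I_n.+1 * 'I_n.+1, exists M : K,
    forall k, `|(P ^+ k) ij.1 ij.2| <= M by move=> ij; exact: bd.
exists (\big[Num.max/0]_ij f ij) => [|k].
  exact: bigmax_ge_id.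
apply: mx_norm_le => [|i j]; first exact: bigmax_ge_id.
by rewrite (le_trans (fP (i, j) k))// le_bigmax.
Qed.

(** * Taylor expansion with a uniform remainder *)

Definition taylor_poly (K : realType) (k : nat) (d : nat -> K) (x : K) : K :=
  \sum_(j < k) x ^+ j / j`!%:R * d j.

Lemma is_derive_taylor_poly (K : realType) (k : nat) (d : nat -> K) (t0 t : K) :
  is_derive t 1 (fun t => taylor_poly k.+1 d (t - t0))
    (taylor_poly k (fun j => d j.+1) (t - t0)).
Proof.
elim: k => [|k IH].
  rewrite (_ : (fun t => _) = cst (d 0%N)); last first.
    apply: funext => x.
    by rewrite /taylor_poly big_ord1 expr0 fact0 divr1 mul1r.
  by rewrite /taylor_poly big_ord0; exact: is_derive_cst.
pose h : K -> K := id - cst t0.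
have hd : is_derive t 1 h 1 by rewrite -[X in is_derive _ _ _ X]subr0; exact: is_deriveB.
rewrite (_ : (fun t => _) = (fun t => taylor_poly k.+1 d (t - t0)) +
    (d k.+1 / (k.+1)`!%:R) *: (h ^+ k.+1)); last first.
  apply: funext => x; rewrite /taylor_poly big_ord_recr/=; congr (_ + _).
  by rewrite /h fctE [RHS]mulrC mulrA mulrAC.
rewrite [X in is_derive _ _ _ X]big_ord_recr /=.
apply: is_deriveD; apply: is_derive_eq.
rewrite factS natrM /h /= fctE.
have k0 : k`!%:R != 0 :> K by rewrite pnatr_eq0 -lt0n fact_gt0.
have k1 : k.+1%:R != 0 :> K by rewrite pnatr_eq0.
rewrite /GRing.scale /= mulr1 -[(- cst t0) t]/(- t0).
by field; rewrite k0 addrC natr1 k1.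
Qed.

(** The mean value theorem without an order between the two points, as needed
    for nodes on both sides of the point of expansion. *)
Lemma mean_value (K : realType) (f df : K -> K) (a b x y : K) :
  (forall t, t \in `]a, b[ -> is_derive t 1 f (df t)) ->
  {within `[a, b], continuous f} -> x \in `[a, b] -> y \in `[a, b] ->
  exists c, [/\ c \in `[a, b], `|c - x| <= `|y - x| &
                f y - f x = df c * (y - x)].
Proof.
move=> fd fc xab yab.
have mvt p q : p < q -> p \in `[a, b] -> q \in `[a, b] ->
    exists2 c, c \in `]p, q[ & f q - f p = df c * (q - p).
  move=> pq; rewrite [p \in _]in_itv [q \in _]in_itv /=.
  move=> /andP[ap _] /andP[_ qb].
  have dI z : z \in `]p, q[ -> is_derive z 1 f (df z).
    rewrite in_itv /= => /andP[pz zq]; apply: fd.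
    by rewrite in_itv /= (le_lt_trans ap pz) (lt_le_trans zq qb).
  have cI : {within `[p, q], continuous f}.
    apply: continuous_subspaceW fc => z /=; rewrite !in_itv /= => /andP[pz zq].
    by rewrite (le_trans ap pz) (le_trans zq qb).
  exact: MVT pq dI cI.
move: (xab) (yab); rewrite !in_itv /= => /andP[ax xb] /andP[ay yb].
have [yx|xy|->] := ltgtP y x.
- have [c + fE] := mvt _ _ yx yab xab.
  rewrite in_itv /= => /andP[yc cx]; exists c; split.
  + by rewrite in_itv /= (ltW (le_lt_trans ay yc)) (ltW (lt_le_trans cx xb)).
  + by rewrite !ltr0_norm ?subr_lt0// lerN2 lerB// ltW.
  + by rewrite -opprB fE -mulrN opprB.
- have [c + fE] := mvt _ _ xy xab yab.
  rewrite in_itv /= => /andP[xc cy]; exists c; split=> //.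
  + by rewrite in_itv /= (ltW (le_lt_trans ax xc)) (ltW (lt_le_trans cy yb)).
  + by rewrite !gtr0_norm ?subr_gt0// lerB// ltW.
- by exists x; rewrite !subrr mulr0.
Qed.

(** By induction on the order: the derivative of the remainder is the remainder
    of the derivative, and the mean value theorem turns a bound [M * d ^+ k] on
    the latter into [M * d ^+ k.+1] for the former.  The same [M], a bound of
    the last derivative, serves at all orders and all points of expansion. *)
Lemma taylor_remainder (K : realType) (k : nat) (a b : K) (g : nat -> K -> K) :
  a <= b ->
  (forall j, (j <= k)%N -> {within `[a, b], continuous (g j)}) ->
  (forall j t, (j < k)%N -> t \in `]a, b[ -> is_derive t (1 : K) (g j) (g j.+1 t)) ->
  exists2 M, 0 <= M & forall t0 t, t0 \in `[a, b] -> t \in `[a, b] ->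
    `|g 0%N t - taylor_poly k (g^~ t0) (t - t0)| <= M * `|t - t0| ^+ k.
Proof.
move=> ab; elim: k g => [|k IH] g gc gd.
  have [c1 _ max1] := EVT_max ab (gc 0%N isT).
  have [c2 _ min2] := EVT_min ab (gc 0%N isT).
  exists (`|g 0%N c1| + `|g 0%N c2|) => [|t0 t _ tab]; first exact: addr_ge0.
  rewrite /taylor_poly big_ord0 subr0 expr0 mulr1.
  move: (max1 _ tab) (min2 _ tab) => ? ?.
  have := ler_norm (g 0%N c1); have := ler_norm (- g 0%N c2); rewrite normrN.
  have := normr_ge0 (g 0%N c1); have := normr_ge0 (g 0%N c2).
  by rewrite ler_norml => *; apply/andP; split; lra.
have [M M0 leM] := IH (fun j => g j.+1) (fun j jk => gc j.+1 jk)
  (fun j t jk => gd j.+1 t jk).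
exists M => // t0 t t0ab tab.
pose r x := g 0%N x - taylor_poly k.+1 (g^~ t0) (x - t0).
pose dr x := g 1%N x - taylor_poly k (fun j => g j.+1 t0) (x - t0).
have rd x : x \in `]a, b[ -> is_derive x 1 r (dr x).
  by move=> xab; apply: is_deriveB; [exact: gd|exact: is_derive_taylor_poly].
have rc : {within `[a, b], continuous r}.
  apply: within_continuousB; first exact: gc.
  apply: derivable_within_continuous => y _.
  by have [] := is_derive_taylor_poly k (g^~ t0) t0 y.
have rt0 : r t0 = 0.
  rewrite /r /taylor_poly big_ord_recl subrr /= fact0 expr0 divr1 mul1r.
  by rewrite big1 ?addr0 ?subrr// => j _; rewrite expr0n /= !mul0r.
have [c [cab ct rE]] := mean_value rd rc t0ab tab.
rewrite -/(r t) -[r t]subr0 -rt0 rE normrM exprSr mulrA ler_wpM2r//.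
by rewrite (le_trans (leM t0 c _ _))// ler_wpM2l// lerXn2r ?nnegrE.
Qed.

(** * The local error *)

Definition stages (K : realType) (s m : nat) (f : K -> 'rV[K]_m) (c : 'cV[K]_s)
    (t h : K) : 'M[K]_(s, m) :=
  \matrix_(i < s) f (t + c i 0 * h).

(** The Taylor polynomial with derivatives [d] at all nodes at once; its
    dependence on the nodes is through the vectors [powv c j] only, on which the
    coefficient matrices of the method act. *)
Definition taylor_stages (K : realType) (s m k : nat) (d : nat -> 'rV[K]_m)
    (c : 'cV[K]_s) (h : K) : 'M[K]_(s, m) :=
  \sum_(j < k) (h ^+ j / j`!%:R) *: (powv c j *m d j).

Definition derivative_sequence (K : realType) (V : normedModType K) (k : nat)
    (a b : K) (g : nat -> K -> V) : Prop :=
  (forall j, (j <= k)%N -> {within `[a, b], continuous (g j)}) /\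
  (forall j t, (j < k)%N -> t \in `]a, b[ ->
    is_derive t (1 : K) (g j) (g j.+1 t)).

Lemma taylor_stagesE (K : realType) (s m k : nat) (d : nat -> 'rV[K]_m)
    (c : 'cV[K]_s) (h : K) i l :
  taylor_stages k d c h i l = taylor_poly k (fun j => d j 0 l) (c i 0 * h).
Proof.
rewrite /taylor_stages summxE; apply: eq_bigr => j _.
by rewrite !mxE big_ord1 !mxE exprMn; ring.
Qed.

Lemma stages_taylor_remainder (K : realType) (s m k : nat) (c : 'cV[K]_s)
    (a b : K) (g : nat -> K -> 'rV[K]_m) :
  a <= b -> derivative_sequence k a b g ->
  exists2 M, 0 <= M & forall t h, 0 <= h -> t \in `[a, b] ->
    (forall i, t + c i 0 * h \in `[a, b]) ->
    `|stages (g 0%N) c t h - taylor_stages k (g^~ t) c h| <= M * h ^+ k.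
Proof.
move=> ab [gc gd].
have /choice[M MP] : forall l : 'I_m, exists M, 0 <= M /\
    forall t0 t, t0 \in `[a, b] -> t \in `[a, b] ->
    `|g 0%N t 0 l - taylor_poly k (fun j => g j t0 0 l) (t - t0)|
      <= M * `|t - t0| ^+ k.
  move=> l; have [||M M0 leM] := @taylor_remainder K k a b (fun j t => g j t 0 l) ab.
  - move=> j jk x.
    apply: (@continuous_comp _ _ _ (g j : subspace _ -> _) (fun v => v 0 l)).
      exact: gc.
    exact: coord_continuous.
  - move=> j t jk tab; have [gdj gE] := gd j t jk tab.
    split; first by move/derivable_mxP: gdj; apply.
    by rewrite -gE derive_mx// mxE.
  - by exists M; split.
pose M' := \big[Num.max/0]_l M l.
have M'0 : 0 <= M' by exact: bigmax_ge_id.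
exists (M' * `|c| ^+ k) => [|t h h0 tab tcab].
  by rewrite mulr_ge0// exprn_ge0.
apply: mx_norm_le => [|i l]; first by rewrite !mulr_ge0// exprn_ge0.
rewrite mxE [X in _ + X]mxE taylor_stagesE [X in X + _]mxE.
have [_ /(_ t _ tab (tcab i))] := MP l.
rewrite addrAC subrr add0r => /le_trans; apply.
rewrite normrM (ger0_norm h0) exprMn mulrA ler_wpM2r ?exprn_ge0//.
rewrite ler_pM ?exprn_ge0//; [exact: (MP l).1|exact: le_bigmax|].
by rewrite lerXn2r ?nnegrE// entry_le_mx_norm.
Qed.

(** The coefficient of [h ^+ j] is a multiple of the stage defect of index [j];
    for [j = 0] it is [e - P e]. *)
Lemma taylor_stages_stage_order (K : realType) (s m k : nat) (c : 'cV[K]_s)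
    (P R : 'M[K]_s) (d : nat -> 'rV[K]_m) (h : K) :
  has_stage_order c P R k ->
  taylor_stages k.+1 d c h - P *m taylor_stages k.+1 d (c - ones K s) h
    - h *: (R *m taylor_stages k (fun j => d j.+1) c h) = 0.
Proof.
move=> [Pe dj].
rewrite /taylor_stages !mulmx_sumr scaler_sumr.
have powv0 (x : 'cV[K]_s) : powv x 0 = ones K s.
  by apply/matrixP => i j; rewrite !mxE.
rewrite !big_ord_recl /= !powv0 expr0 fact0 divr1 !scale1r mulmxA Pe.
rewrite opprD addrACA subrr add0r -!sumrB big1// => j _.
have := dj j.+1; rewrite /= ltn_ord => /(_ isT) /eqP.
rewrite /stage_defect scaler_eq0 invr_eq0 pnatr_eq0 -leqn0 leqNgt fact_gt0 /=.
rewrite subr_eq0 => /eqP defect.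
rewrite -!scalemxAr scalerA /bump /= add1n -scalerBr mulmxA -mulmxBl defect.
rewrite -scalemxAl scalerA mulmxA -scalerBl exprS factS natrM.
rewrite (_ : _ - _ = 0) ?scale0r//.
have j0 : j`!%:R != 0 :> K by rewrite pnatr_eq0 -lt0n fact_gt0.
have j1 : j.+1%:R != 0 :> K by rewrite pnatr_eq0.
by field; rewrite j0 addrC natr1 j1.
Qed.

Lemma vander_unit (K : realType) (s : nat) (c : 'cV[K]_s) :
  (forall i j : 'I_s, c i 0 = c j 0 -> i = j) -> vander c \in unitmx.
Proof.
move=> c_inj; rewrite /vander unitmx_tr unitmxE unitfE det_Vandermonde.
apply/prodf_neq0 => i _; apply/prodf_neq0 => j ij.
by rewrite !mxE subr_eq0; apply: contraTneq ij => /c_inj ->; rewrite ltnn.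
Qed.

(** Extrapolation is exact because [powv c j] is column [j] of [vander c]. *)
Lemma taylor_stages_extrapolation (K : realType) (s m : nat) (c : 'cV[K]_s)
    (d : nat -> 'rV[K]_m) (h : K) :
  (forall i j : 'I_s, c i 0 = c j 0 -> i = j) ->
  vander c *m invmx (vander (c - ones K s)) *m
    taylor_stages s d (c - ones K s) h = taylor_stages s d c h.
Proof.
move=> c_inj; have powvE (x : 'cV[K]_s) (j : 'I_s) : powv x j = col j (vander x).
  by apply/matrixP => i k; rewrite !mxE ord1.
rewrite /taylor_stages mulmx_sumr; apply: eq_bigr => j _.
rewrite -scalemxAr mulmxA; congr (_ *: (_ *m _)).
rewrite !powvE !colE mulmxA mulmxKV//.
by apply: vander_unit => i k; rewrite !mxE => /addIr; exact: c_inj.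
Qed.

(** The Taylor polynomials cancel by [taylor_stages_stage_order] and
    [taylor_stages_extrapolation], so that only remainders are left.  Those of
    [u] have order [s.+1]; those of its derivative and of [F0 \o u] have order
    [s] and carry a factor [h]. *)
Lemma local_error (K : realType) (s m : nat) (c : 'cV[K]_s) (P R S2 : 'M[K]_s)
    (a b : K) (g f : nat -> K -> 'rV[K]_m) :
  (forall i j : 'I_s, c i 0 = c j 0 -> i = j) ->
  has_stage_order c P R s -> a <= b ->
  derivative_sequence s.+1 a b g -> derivative_sequence s a b f ->
  exists2 M, 0 <= M & forall t h, 0 <= h -> t \in `[a, b] ->
    (forall i, t + c i 0 * h \in `[a, b]) ->
    (forall i, t + (c i 0 - 1) * h \in `[a, b]) ->
    `|stages (g 0%N) c t h - P *m stages (g 0%N) (c - ones K s) t h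
      - h *: (Qhat c R S2 *m stages (f 0%N) (c - ones K s) t h)
      - h *: (Rhat R S2 *m stages (f 0%N) c t h)
      - h *: (R *m (stages (g 1%N) c t h - stages (f 0%N) c t h))|
    <= M * h ^+ s.+1.
Proof.
move=> c_inj so ab gS fS.
have g1S : derivative_sequence s a b (fun j => g j.+1).
  by have [gc gd] := gS; split=> [j js|j t js]; [exact: gc|exact: gd].
have [M1 M1_ge0 leM1] := stages_taylor_remainder c ab gS.
have [M2 M2_ge0 leM2] := stages_taylor_remainder (c - ones K s) ab gS.
have [M3 M3_ge0 leM3] := stages_taylor_remainder c ab g1S.
have [M4 M4_ge0 leM4] := stages_taylor_remainder c ab fS.
have [M5 M5_ge0 leM5] := stages_taylor_remainder (c - ones K s) ab fS.
set Q := Qhat c R S2.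
pose nrm (A : 'M[K]_s) := s%:R * `|A|.
have nrm_ge0 A : 0 <= nrm A by rewrite mulr_ge0.
have nrmP (A : 'M[K]_s) (B : 'M[K]_(s, m)) x : `|B| <= x -> `|A *m B| <= nrm A * x.
  by move=> Bx; rewrite (le_trans (mx_norm_mul A B))// ler_wpM2l.
clearbody nrm.
exists (M1 + nrm P * M2 + nrm R * M3 + nrm (R *m (1%:M - S2)) * M4 + nrm Q * M5).
  by rewrite !addr_ge0// mulr_ge0.
move=> t h h0 tab tc tc1.
have tc1' i : t + (c - ones K s) i 0 * h \in `[a, b] by rewrite !mxE; exact: tc1.
move: (leM1 t h h0 tab tc) (leM2 t h h0 tab tc1') (leM3 t h h0 tab tc)
  (leM4 t h h0 tab tc) (leM5 t h h0 tab tc1').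
set U := stages _ c t h; set U' := stages _ (c - _) t h.
set DU := stages (g 1%N) c t h.
set Phi := stages (f 0%N) c t h; set Phi' := stages (f 0%N) (c - _) t h.
set T1 := taylor_stages _ _ _ _; set T2 := taylor_stages _ _ _ _.
set T3 := taylor_stages _ _ _ _; set T4 := taylor_stages _ _ _ _.
set T5 := taylor_stages _ _ _ _.
move=> le1 le2 le3 le4 le5.
have T123 : T1 = P *m T2 + h *: (R *m T3).
  have /eqP := taylor_stages_stage_order (g^~ t) h so.
  by rewrite -addrA -opprD subr_eq0 => /eqP.
have T45 : Q *m T5 = R *m (1%:M - S2) *m T4.
  rewrite /T4 -(taylor_stages_extrapolation _ h c_inj) /Q /Qhat -!mulmxA.
  by rewrite /T5.
have -> : U - P *m U' - h *: (Q *m Phi') - h *: (Rhat R S2 *m Phi)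
    - h *: (R *m (DU - Phi)) =
    (U - T1) - P *m (U' - T2) - h *: (R *m (DU - T3))
    + h *: (R *m (1%:M - S2) *m (Phi - T4)) - h *: (Q *m (Phi' - T5)).
  rewrite [T1 in RHS]T123 !(mulmxBr _ _ T4) !(mulmxBr _ _ T5) T45.
  rewrite /Rhat (mulmxBr R 1%:M) mulmx1 !(mulmxBl, mulmxBr) !scalerBr.
  move: (P *m U') (P *m T2) (h *: (R *m DU)) (h *: (R *m Phi)) (h *: (R *m T3))
    (h *: (R *m T4)) (h *: (R *m S2 *m Phi)) (h *: (R *m S2 *m T4))
    (h *: (Q *m Phi')) => X1 X2 X3 X4 X5 X6 X7 X8 X9.
  by apply/matrixP => i j; rewrite !mxE; ring.
rewrite !mulrDl exprS -!mulrA.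
have scale_le (A : 'M[K]_s) (B : 'M[K]_(s, m)) M : `|B| <= M * h ^+ s ->
    `|h *: (A *m B)| <= nrm A * (M * (h * h ^+ s)).
  move=> leB; rewrite normrZ ger0_norm// (mulrCA M) (mulrCA (nrm A)) ler_wpM2l//.
  exact: nrmP.
rewrite (le_trans (ler_normB _ _))// lerD ?scale_le//.
rewrite (le_trans (ler_normD _ _))// lerD ?scale_le//.
rewrite (le_trans (ler_normB _ _))// lerD ?scale_le//.
rewrite (le_trans (ler_normB _ _))// -exprS lerD ?nrmP//.
Qed.

(** * The differential equation up to the end points *)

Lemma lipschitz_constant (K : realType) (V W : normedModType K) (F : V -> W)
    (D : set V) :
  [lipschitz F x | x in D] ->
  exists2 L, 0 <= L & forall x y, D x -> D y -> `|F x - F y| <= L * `|x - y|.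
Proof.
move=> [M [_ lipM]]; exists (`|M| + 1) => [|x y Dx Dy]; first exact: addr_ge0.
apply: (lipM (`|M| + 1) _ (x, y)) => //.
by rewrite (le_lt_trans (ler_norm M))// ltrDl.
Qed.

(** Points between [t] and the midpoint of the segment are interior. *)
Lemma segment_interior_approx (K : realType) (a b t d : K) :
  a < b -> t \in `[a, b] -> 0 < d ->
  exists2 x, x \in `]a, b[ & `|t - x| < d.
Proof.
move=> ab; rewrite in_itv /= => /andP[a_t t_b] d0.
pose q := d / (d + (b - a)); pose mid := (a + b) / 2.
have ba0 : 0 < b - a by rewrite subr_gt0.
have dba : 0 < d + (b - a) by exact: addr_gt0.
have q0 : 0 < q by exact: divr_gt0.
have q1 : q < 1 by rewrite ltr_pdivrMr// mul1r ltrDl.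
exists (t + q * (mid - t)).
  by rewrite in_itv /= /mid; apply/andP; split; nra.
rewrite opprD addrA subrr add0r normrN normrM (gtr0_norm q0).
rewrite (@le_lt_trans _ _ (q * (b - a)))//.
  rewrite ler_wpM2l ?(ltW q0)// ler_norml /mid; apply/andP; split; lra.
by rewrite /q mulrAC ltr_pdivrMr// ltr_pM2l// ltrDr.
Qed.

(** Stage times may be end points of the segment, where the equation is not
    assumed; both sides are continuous there. *)
Lemma ode_on_segment (K : realType) (m : nat) (F0 F1 : 'rV[K]_m -> 'rV[K]_m)
    (D : set 'rV[K]_m) (s : nat) (a b : K) (u0 : 'rV[K]_m) (u : K -> 'rV[K]_m)
    (g : nat -> K -> 'rV[K]_m) :
  a < b -> nonstiff_solution F0 F1 D s a b u0 u ->
  derivative_sequence s.+1 a b g -> g 0%N = u ->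
  forall t, t \in `[a, b] -> g 1%N t = F0 (u t) + F1 (u t).
Proof.
move=> ab [lip0 lip1 uD [_ ode] _] [gc gd] gu t tab.
have [L0 L0_ge0 leL0] := lipschitz_constant lip0.
have [L1 L1_ge0 leL1] := lipschitz_constant lip1.
have /subspace_continuousP/(_ t tab)/cvgrPdist_lt g0c := gc 0%N isT.
have /subspace_continuousP/(_ t tab)/cvgrPdist_lt g1c := gc 1%N isT.
have uDs x : x \in `[a, b] -> D (u x) by move=> xab; apply: nbhs_singleton; exact: uD.
apply/eqP; rewrite -subr_eq0 -normr_le0; apply/ler_addgt0Pr => e e0.
rewrite add0r.
pose L := 1 + L0 + L1; have L0' : 0 < L by rewrite /L; lra.
have eL0 : 0 < e / L by exact: divr_gt0.
have : nbhs t (fun x => x \in `[a, b] ->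
    `|g 0%N t - g 0%N x| < e / L /\ `|g 1%N t - g 1%N x| < e / L).
  by have := filterI (g0c _ eL0) (g1c _ eL0); apply.
move=> /nbhs_ballP[d /= d0 dP].
have [x xab xt] := segment_interior_approx ab tab d0.
have xab' : x \in `[a, b] by exact: subset_itv_oo_cc xab.
have [] := dP x xt xab'; rewrite gu => ux g1x.
have g1xE : g 1%N x = F0 (u x) + F1 (u x).
  have [_ <-] := ode x xab; have := gd 0%N x isT xab; rewrite gu => -[_ <-].
  by [].
have -> : g 1%N t - (F0 (u t) + F1 (u t)) = (g 1%N t - g 1%N x) -
    ((F0 (u t) - F0 (u x)) + (F1 (u t) - F1 (u x))).
  rewrite g1xE; move: (F0 _) (F0 _) (F1 _) (F1 _) (g _ _) => *.
  by apply/matrixP => i j; rewrite !mxE; ring.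
rewrite (le_trans (ler_normB _ _))//.
have le0 := leL0 _ _ (uDs t tab) (uDs x xab').
have le1 := leL1 _ _ (uDs t tab) (uDs x xab').
have leD := ler_normD (F0 (u t) - F0 (u x)) (F1 (u t) - F1 (u x)).
have eE : e = e / L + L0 * (e / L) + L1 * (e / L).
  by rewrite -{1}[e / L]mul1r -!mulrDl -/L mulrC divfK// gt_eqF.
have := ler_wpM2l L0_ge0 (ltW ux); have := ler_wpM2l L1_ge0 (ltW ux).
move: g1x eE; set q := e / L => g1x eE h1 h0.
lra.
Qed.

(** * Propagation of errors *)

Lemma discrete_gronwall (K : realType) (N : nat) (x : nat -> K) (A B : K) :
  0 <= B ->
  (forall n, (n <= N)%N -> x n <= A + B * \sum_(k < n) x k) ->
  forall n, (n <= N)%N -> x n <= A * (1 + B) ^+ n.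
Proof.
move=> B0 xle n; elim/ltn_ind: n => n IH nN.
have sumE : B * \sum_(k < n) A * (1 + B) ^+ k = A * (1 + B) ^+ n - A.
  elim: n {IH nN} => [|n IHn]; first by rewrite big_ord0 expr0; ring.
  by rewrite big_ord_recr /= mulrDr IHn exprSr; ring.
rewrite (le_trans (xle n nN))// -[leRHS](subrK A) addrC lerD2r -sumE ler_wpM2l//.
by apply: ler_sum => k _; rewrite IH// (leq_trans (ltnW (ltn_ord k)) nN).
Qed.

(** Variation of constants: [e n] is the sum of [P ^+ n *m e 0] and of the terms
    [P ^+ (n - k.+1) *m r k]. *)
Lemma discrete_duhamel (K : realType) (s m N : nat) (P : 'M[K]_s.+1) (M : K)
    (e r : nat -> 'M[K]_(s.+1, m)) :
  0 <= M -> (forall k, `|P ^+ k| <= M) ->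
  (forall n, (n < N)%N -> e n.+1 = P *m e n + r n) ->
  forall n, (n <= N)%N ->
    `|e n| <= s.+1%:R * M * (`|e 0%N| + \sum_(k < n) `|r k|).
Proof.
move=> M0 PM rec n nN.
have eE : e n = P ^+ n *m e 0%N + \sum_(k < n) P ^+ (n - k.+1) *m r k.
  elim: n nN => [|n IH] nN; first by rewrite big_ord0 addr0 expr0 mul1mx.
  rewrite rec// IH ?(ltnW nN)// mulmxDr mulmxA -[P *m _]exprS -addrA; congr (_ + _).
  rewrite big_ord_recr /= subnn expr0 mul1mx mulmx_sumr; congr (_ + _).
  by apply: eq_bigr => k _; rewrite mulmxA -[P *m _]exprS subSn.
have PMle k (B : 'M[K]_(s.+1, m)) : `|P ^+ k *m B| <= s.+1%:R * M * `|B|.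
  by rewrite (le_trans (mx_norm_mul _ _))// ler_wpM2r// ler_wpM2l.
rewrite eE (le_trans (ler_normD _ _))// mulrDr lerD// mulr_sumr.
by rewrite (le_trans (ler_norm_sum _ _ _))// ler_sum.
Qed.

(** The right-hand side [r n] involves the new error [e n.+1], as the scheme is
    implicit; for small [h] its contribution is absorbed on the left, which costs
    the factor [2]. *)
Lemma stability (K : realType) (s m N : nat) (P : 'M[K]_s.+1) (M B h d : K)
    (e r : nat -> 'M[K]_(s.+1, m)) :
  0 <= M -> (forall k, `|P ^+ k| <= M) -> 0 <= B -> 0 <= h -> 0 <= d ->
  s.+1%:R * M * (h * B) <= 1 / 2 ->
  (forall n, (n < N)%N -> e n.+1 = P *m e n + r n) ->
  (forall n, (n < N)%N -> `|r n| <= h * B * (`|e n| + `|e n.+1|) + d) ->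
  forall n, (n <= N)%N -> `|e n| <=
    2 * (s.+1%:R * M) * (`|e 0%N| + N%:R * d) *
    expR (4 * (s.+1%:R * M) * B * (N%:R * h)).
Proof.
move=> M0 PM B0 h0 d0 small rec rle.
set Q := s.+1%:R * M in small *; have Q0 : 0 <= Q by rewrite mulr_ge0.
have step n : (n <= N)%N -> `|e n| <= 2 * Q * (`|e 0%N| + N%:R * d) +
    4 * Q * (h * B) * \sum_(k < n) `|e k|.
  move=> nN; have := discrete_duhamel M0 PM rec nN; rewrite -/Q.
  have sumr : \sum_(k < n) `|r k| <=
      h * B * (2 * \sum_(k < n) `|e k| + `|e n|) + N%:R * d.
    rewrite (@le_trans _ _ (\sum_(k < n) (h * B * (`|e k| + `|e k.+1|) + d)))//.
      by apply: ler_sum => k _; rewrite rle// (leq_trans (ltn_ord k)).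
    rewrite big_split /= sumr_const card_ord -[d *+ n]mulr_natl lerD//; last first.
      by rewrite ler_wpM2r// ler_nat.
    rewrite -mulr_sumr ler_wpM2l ?mulr_ge0// big_split /= mulr_natl mulr2n -addrA.
    rewrite lerD2l; elim: n {nN} => [|n IH]; first by rewrite !big_ord0 add0r.
    by rewrite !big_ord_recr /= lerD2r.
  move=> eQ; have := ler_wpM2l Q0 sumr.
  have := normr_ge0 (e n); have : 0 <= \sum_(k < n) `|e k| by exact: sumr_ge0.
  have := ler_wpM2r (normr_ge0 (e n)) small.
  move: eQ; rewrite !mulrDr; set S := \sum_(k < n) `|e k|; nra.
have B'0 : 0 <= 4 * Q * (h * B) by rewrite !mulr_ge0.
move=> n nN; rewrite (le_trans (discrete_gronwall B'0 step nN))// ler_wpM2l//.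
  by rewrite !mulr_ge0// addr_ge0// mulr_ge0.
rewrite (@le_trans _ _ (expR (4 * Q * (h * B)) ^+ n))//.
  by rewrite lerXn2r ?nnegrE ?expR_ge0 ?addr_ge0// expR_ge1Dx.
rewrite -expRM_natl ler_expR.
rewrite (_ : 4 * Q * B * (N%:R * h) = N%:R * (4 * Q * (h * B))); last by ring.
by rewrite ler_wpM2r// ler_nat.
Qed.

(** * Solvability of the implicit equations *)

(** The radius is uniform because the curve is compact. *)
Lemma tube (K : realType) (m : nat) (D : set 'rV[K]_m) (a b : K)
    (u : K -> 'rV[K]_m) :
  {within `[a, b], continuous u} -> (forall t, t \in `[a, b] -> nbhs (u t) D) ->
  exists2 rho, 0 < rho & forall t x, t \in `[a, b] -> `|x - u t| <= rho -> D x.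
Proof.
move=> uc uD.
have uK : compact (u @` `[a, b]).
  by apply: continuous_compact => //; exact: (@segment_compact K a b).
have cov : \forall r \near (0 : K)^'+, u @` `[a, b] `<=` 
    [set y | forall x, `|x - y| <= r -> D x].
  have /compact_near_coveringP ncov := uK; apply: ncov => _ [t tab <-].
  have /nbhs_ballP[e /= e0 eD] := uD t tab.
  exists (ball (u t) (e / 2), [set r | r < e / 2]) => /=.
    have e2 : 0 < e / 2 by exact: divr_gt0.
    by split; [exact: nbhsx_ballx|exact: nbhs_right_lt].
  move=> [y r] /= [yt re] x xy; apply: eD.
  rewrite -ball_normE /= in yt *; rewrite /ball_ /= in yt *.
  rewrite (splitr e) -(subrKA y) (le_lt_trans (ler_normD _ _))// ltrD//.
  by rewrite distrC (le_lt_trans xy).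
have [r [r0 rD]] : exists r : K, 0 < r /\ u @` `[a, b] `<=`
    [set y | forall x, `|x - y| <= r -> D x].
  near (0 : K)^'+ => r; exists r; split; first by near: r; exact: nbhs_right_gt.
  by near: r.
exists r => // t x tab; apply: (rD (u t)); by exists t.
Unshelve. all: by end_near. Qed.

Lemma fixed_point_ball (K : realType) (X : completeNormedModType K) (f : X -> X)
    (v : X) (rho : K) :
  0 <= rho -> (forall x, `|x - v| <= rho -> `|f x - v| <= rho) ->
  (forall x y, `|x - v| <= rho -> `|y - v| <= rho ->
    `|f x - f y| <= 1 / 2 * `|x - y|) ->
  exists2 x, `|x - v| <= rho & x = f x.
Proof.
move=> rho0 f_ball f_contr; pose U := [set x | `|x - v| <= rho].
have fU : set_fun U U f by move=> x; exact: f_ball.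
pose F : {fun U >-> U} := HB.pack f (isFun.Build _ _ U U f fU).
have Fc : is_contraction F.
  exists (1 / 2)%:nng; split=> /=; first lra.
  by move=> [x y] /= [Ux Uy]; exact: f_contr.
have Ucl : closed U.
  rewrite (_ : U = (fun x => `|x - v|) @^-1` [set r | r <= rho])//.
  apply: closed_comp; last exact: closed_le.
  move=> x _; apply: cvg_norm; apply: cvgB; first exact: cvg_id.
  exact: cvg_cst.
have U0 : U !=set0 by exists v; rewrite /U /= subrr normr0.
by have [x Ux xE] := banach_fixed_point Fc Ucl U0; exists x.
Qed.

(** Joins the complete and the normed structure of matrices, for the contraction
    principle. *)
HB.instance Definition _ (K : realType) (s m : nat) :=
  NormedModule.on 'M[K]_(s, m).

Lemma appF_lipschitz (K : realType) (s m : nat) (F : 'rV[K]_m -> 'rV[K]_m)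
    (D : set 'rV[K]_m) (L : K) (v w : 'M[K]_(s, m)) :
  0 <= L -> (forall x y, D x -> D y -> `|F x - F y| <= L * `|x - y|) ->
  (forall i, D (row i v)) -> (forall i, D (row i w)) ->
  `|appF F v - appF F w| <= L * `|v - w|.
Proof.
move=> L0 lip Dv Dw; apply: mx_norm_le_rows => [|i]; first exact: mulr_ge0.
rewrite linearB /= !rowK (le_trans (lip _ _ (Dv i) (Dw i)))// ler_wpM2l//.
by rewrite -linearB row_le_mx_norm.
Qed.

(** The implicit equation of a step from [w] reads [x = imex_map ... w x]. *)
Definition imex_map (K : realType) (s m : nat) (P Q0 R0 R : 'M[K]_s)
    (F0 F1 : 'rV[K]_m -> 'rV[K]_m) (h : K) (w x : 'M[K]_(s, m)) : 'M[K]_(s, m) :=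
  P *m w + h *: (Q0 *m appF F0 w) + h *: (R0 *m appF F0 x)
         + h *: (R *m appF F1 x).

(** Up to the factor [h], a Lipschitz constant of [imex_map] in both stage vectors
    once the term [P *m w] is set aside.  The factor [s] comes from
    [mx_norm_mul]. *)
Definition imex_lip (K : realType) (s : nat) (Q0 R0 R : 'M[K]_s) (L0 L1 : K) : K :=
  s%:R * (`|Q0| * L0 + `|R0| * L0 + `|R| * L1).

Lemma imex_map_lipschitz (K : realType) (s m : nat) (P Q0 R0 R : 'M[K]_s)
    (F0 F1 : 'rV[K]_m -> 'rV[K]_m) (D : set 'rV[K]_m) (L0 L1 h : K)
    (w w' x x' : 'M[K]_(s, m)) :
  0 <= L0 -> (forall x y, D x -> D y -> `|F0 x - F0 y| <= L0 * `|x - y|) ->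
  0 <= L1 -> (forall x y, D x -> D y -> `|F1 x - F1 y| <= L1 * `|x - y|) ->
  0 <= h ->
  (forall i, D (row i w)) -> (forall i, D (row i w')) ->
  (forall i, D (row i x)) -> (forall i, D (row i x')) ->
  `|imex_map P Q0 R0 R F0 F1 h w x - imex_map P Q0 R0 R F0 F1 h w' x'
    - P *m (w - w')|
  <= h * imex_lip Q0 R0 R L0 L1 * (`|w - w'| + `|x - x'|).
Proof.
move=> L0_ge0 lip0 L1_ge0 lip1 h0 Dw Dw' Dx Dx'.
have le0w := appF_lipschitz L0_ge0 lip0 Dw Dw'.
have le0x := appF_lipschitz L0_ge0 lip0 Dx Dx'.
have le1x := appF_lipschitz L1_ge0 lip1 Dx Dx'.
have -> : imex_map P Q0 R0 R F0 F1 h w x - imex_map P Q0 R0 R F0 F1 h w' x'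
    - P *m (w - w') = h *: (Q0 *m (appF F0 w - appF F0 w')
      + R0 *m (appF F0 x - appF F0 x') + R *m (appF F1 x - appF F1 x')).
  rewrite /imex_map !mulmxBr.
  move: (P *m w) (P *m w') (Q0 *m _) (Q0 *m _) (R0 *m _) (R0 *m _) (R *m _) (R *m _).
  by move=> *; apply/matrixP => i j; rewrite !mxE; ring.
have mul_le (A : 'M[K]_s) (B : 'M[K]_(s, m)) L y : `|B| <= L * y ->
    `|A *m B| <= s%:R * `|A| * L * y.
  move=> By; rewrite (le_trans (mx_norm_mul A B))// -[leRHS]mulrA.
  by rewrite ler_wpM2l// mulr_ge0.
rewrite normrZ (ger0_norm h0) -mulrA ler_wpM2l//.
rewrite (le_trans (ler_normD _ _))//.
have := ler_normD (Q0 *m (appF F0 w - appF F0 w')) (R0 *m (appF F0 x - appF F0 x')).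
have := mul_le Q0 _ _ _ le0w; have := mul_le R0 _ _ _ le0x.
have := mul_le R _ _ _ le1x.
have : 0 <= s%:R * `|Q0| * L0 * `|x - x'| by rewrite !mulr_ge0.
have : 0 <= s%:R * `|R0| * L0 * `|w - w'| by rewrite !mulr_ge0.
have : 0 <= s%:R * `|R| * L1 * `|w - w'| by rewrite !mulr_ge0.
rewrite /imex_lip; lra.
Qed.

(** * Convergence *)

Lemma near0_mul_le (K : realType) (X rho : K) : 0 <= X -> 0 < rho ->
  \forall h \near 0^'+, h * X <= rho.
Proof.
move=> X0 rho0; near=> h.
have h0 : 0 < h by near: h; exact: nbhs_right_gt.
have hX : h < rho / (X + 1).
  by near: h; apply: nbhs_right_lt; rewrite divr_gt0// ltr_wpDl.
move: hX; rewrite ltr_pdivlMr ?ltr_wpDl// => hX.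
by rewrite (le_trans _ (ltW hX))// ler_wpM2l ?(ltW h0)// lerDl.
Unshelve. all: by end_near. Qed.

Lemma starting_error (K : realType) (s m p : nat) (c : 'cV[K]_s)
    (u : K -> 'rV[K]_m) (w0 : K -> 'M[K]_(s, m)) :
  (forall i : 'I_s,
     (fun h : K => row i (w0 h) - u (stage_time c h 0 i))
       =O_ (0^'+) (fun h : K => h ^+ p)) ->
  exists2 C0, 0 <= C0 & \forall h \near 0^'+,
    forall i, `|row i (w0 h) - u (stage_time c h 0 i)| <= C0 * h ^+ p.
Proof.
move=> w0O.
have /choice[C CP] : forall i : 'I_s, exists C, \forall h \near 0^'+,
    `|row i (w0 h) - u (stage_time c h 0 i)| <= C * h ^+ p.
  move=> i; have /eqO_exP[C C0 CP] := w0O i.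
  exists C; near=> h; have h0 : 0 < h by near: h; exact: nbhs_right_gt.
  rewrite -[h ^+ p]ger0_norm ?exprn_ge0 ?(ltW h0)//.
  by near: h.
exists (\big[Num.max/0]_i C i); first exact: bigmax_ge_id.
near=> h => i; have h0 : 0 < h by near: h; exact: nbhs_right_gt.
rewrite (@le_trans _ _ (C i * h ^+ p))//.
  by move: i; near: h; exact: filter_forall.
by rewrite ler_wpM2r ?exprn_ge0 ?(ltW h0)// le_bigmax.
Unshelve. all: by end_near. Qed.

Definition exact_stages (K : realType) (s m : nat) (u : K -> 'rV[K]_m)
    (c : 'cV[K]_s) (h : K) (n : nat) : 'M[K]_(s, m) := stages u c (n%:R * h) h.

Lemma row_exact_stages (K : realType) (s m : nat) (u : K -> 'rV[K]_m)
    (c : 'cV[K]_s) (h : K) (n : nat) (i : 'I_s) :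
  row i (exact_stages u c h n) = u (stage_time c h n i).
Proof. by rewrite rowK. Qed.

Lemma appF_stages (K : realType) (s m : nat) (F : 'rV[K]_m -> 'rV[K]_m)
    (u : K -> 'rV[K]_m) (c : 'cV[K]_s) (t h : K) :
  appF F (stages u c t h) = stages (F \o u) c t h.
Proof. by apply/row_matrixP => i; rewrite !rowK. Qed.

(** The old stages lie at [t + (c_i - 1) h] when [t] is the new grid point, and
    [t] itself belongs to the segment because it is the last old stage. *)
Lemma imex_consistency (K : realType) (s m : nat) (c : 'cV[K]_s.+1)
    (P R S2 : 'M[K]_s.+1) (F0 F1 : 'rV[K]_m -> 'rV[K]_m) (D : set 'rV[K]_m)
    (a b : K) (u0 : 'rV[K]_m) (u : K -> 'rV[K]_m) :
  (forall i j : 'I_s.+1, c i 0 = c j 0 -> i = j) -> c ord_max 0 = 1 ->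
  has_stage_order c P R s.+1 -> a < b ->
  nonstiff_solution F0 F1 D s.+1 a b u0 u ->
  exists2 M, 0 <= M & forall h n, 0 <= h ->
    (forall i, stage_time c h n i \in `[a, b]) ->
    (forall i, stage_time c h n.+1 i \in `[a, b]) ->
    `|exact_stages u c h n.+1 -
      imex_map P (Qhat c R S2) (Rhat R S2) R F0 F1 h
        (exact_stages u c h n) (exact_stages u c h n.+1)| <= M * h ^+ s.+2.
Proof.
move=> c_inj c_max so ab sol; have [_ _ _ _ [[g [g0 gc gd]] [f [f0 fc fd]]]] := sol.
have [M M0 leM] := local_error S2 c_inj so (ltW ab) (conj gc gd) (conj fc fd).
exists M => // h n h0 tn tn1.
have tE : n.+1%:R * h = stage_time c h n ord_max.
  by rewrite /stage_time c_max -natr1 mulrDl.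
have prev i : n.+1%:R * h + (c i 0 - 1) * h = stage_time c h n i.
  by rewrite /stage_time -natr1; ring.
have := leM (n.+1%:R * h) h h0; rewrite {1}tE => /(_ (tn _) tn1).
have -> : stages (g 0%N) (c - ones K s.+1) (n.+1%:R * h) h = exact_stages u c h n.
  by apply/row_matrixP => i; rewrite !rowK g0 !mxE prev.
have -> : stages (f 0%N) (c - ones K s.+1) (n.+1%:R * h) h =
    appF F0 (exact_stages u c h n).
  by apply/row_matrixP => i; rewrite !rowK f0 !mxE prev.
have -> : stages (g 1%N) c (n.+1%:R * h) h - stages (f 0%N) c (n.+1%:R * h) h =
    appF F1 (exact_stages u c h n.+1).
  apply/row_matrixP => i; rewrite linearB /= !rowK f0.
  rewrite (ode_on_segment ab sol (conj gc gd) g0 (tn1 i)) /=.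
  by rewrite addrAC subrr add0r.
rewrite f0 g0 -appF_stages -/(exact_stages u c h n.+1) => H.
rewrite /imex_map !opprD !addrA; apply: H => i.
by rewrite prev.
Qed.

(** The difference of a run and a sequence [U] with defect [d] obeys the recursion
    of [stability]; the Lipschitz terms go into the perturbation. *)
Lemma imex_run_error (K : realType) (s m N : nat) (P Q0 R0 R : 'M[K]_s.+1)
    (F0 F1 : 'rV[K]_m -> 'rV[K]_m) (D : set 'rV[K]_m) (L0 L1 MP h d : K)
    (w0 : 'M[K]_(s.+1, m)) (w U : nat -> 'M[K]_(s.+1, m)) :
  0 <= L0 -> (forall x y, D x -> D y -> `|F0 x - F0 y| <= L0 * `|x - y|) ->
  0 <= L1 -> (forall x y, D x -> D y -> `|F1 x - F1 y| <= L1 * `|x - y|) ->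
  0 <= MP -> (forall k, `|P ^+ k| <= MP) -> 0 <= h -> 0 <= d ->
  s.+1%:R * MP * (h * imex_lip Q0 R0 R L0 L1) <= 1 / 2 ->
  (forall n i, (n <= N)%N -> D (row i (U n))) ->
  (forall n, (n < N)%N ->
    `|U n.+1 - imex_map P Q0 R0 R F0 F1 h (U n) (U n.+1)| <= d) ->
  imex_run P Q0 R0 R F0 F1 D h N w0 w ->
  forall n, (n <= N)%N -> `|w n - U n| <=
    2 * (s.+1%:R * MP) * (`|w0 - U 0%N| + N%:R * d) *
    expR (4 * (s.+1%:R * MP) * imex_lip Q0 R0 R L0 L1 * (N%:R * h)).
Proof.
move=> L0_ge0 lip0 L1_ge0 lip1 MP0 PM h0 d0 small UD Ud [w00 wstep wD].
pose e n := w n - U n; pose r n := e n.+1 - P *m e n.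
have B0 : 0 <= imex_lip Q0 R0 R L0 L1 by rewrite mulr_ge0// !addr_ge0// mulr_ge0.
rewrite -w00; apply: (@stability K s m N P MP _ h d e r) => // n nN.
  by rewrite /r addrC subrK.
have nN' := ltnW nN.
have -> : r n = (imex_map P Q0 R0 R F0 F1 h (w n) (w n.+1)
    - imex_map P Q0 R0 R F0 F1 h (U n) (U n.+1) - P *m (w n - U n))
    - (U n.+1 - imex_map P Q0 R0 R F0 F1 h (U n) (U n.+1)).
  rewrite /r {1}/e [w n.+1 in LHS](wstep n.+1)//= -/(imex_map _ _ _ _ _ _ _ _ _).
  move: (imex_map _ _ _ _ _ _ _ _ _) (imex_map _ _ _ _ _ _ _ _ _) (P *m _) => *.
  by apply/matrixP => i j; rewrite !mxE; ring.
rewrite (le_trans (ler_normB _ _))// lerD ?Ud//.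
by apply: (imex_map_lipschitz _ _ _ _ L0_ge0 lip0 L1_ge0 lip1) => // i;
  do ?[exact: wD|exact: UD].
Qed.

(** The contraction principle in the ball of radius [rho] around [V'], the
    expected value of the new stages.  The last hypothesis makes the ball
    invariant; contractivity only takes a small [h]. *)
Lemma imex_step_exists (K : realType) (s m : nat) (P Q0 R0 R : 'M[K]_s)
    (F0 F1 : 'rV[K]_m -> 'rV[K]_m) (D : set 'rV[K]_m) (L0 L1 h d rho : K)
    (w V V' : 'M[K]_(s, m)) :
  0 <= L0 -> (forall x y, D x -> D y -> `|F0 x - F0 y| <= L0 * `|x - y|) ->
  0 <= L1 -> (forall x y, D x -> D y -> `|F1 x - F1 y| <= L1 * `|x - y|) ->
  0 <= h -> 0 <= rho ->
  h * imex_lip Q0 R0 R L0 L1 <= 1 / 2 ->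
  (forall i, D (row i w)) -> (forall i, D (row i V)) ->
  (forall i x, `|x - row i V'| <= rho -> D x) ->
  `|V' - imex_map P Q0 R0 R F0 F1 h V V'| <= d ->
  h * imex_lip Q0 R0 R L0 L1 * (`|w - V| + rho) + s%:R * `|P| * `|w - V| + d
    <= rho ->
  exists x, imex_step P Q0 R0 R F0 F1 h w x /\ forall i, D (row i x).
Proof.
move=> L0_ge0 lip0 L1_ge0 lip1 h0 rho0 hB wD VD V'D Vd small.
have B0 : 0 <= imex_lip Q0 R0 R L0 L1 by rewrite mulr_ge0// !addr_ge0// mulr_ge0.
have ballD x i : `|x - V'| <= rho -> D (row i x).
  by move=> xV; apply: (V'D i); rewrite -linearB (le_trans (row_le_mx_norm _ _)).
have V'V' : `|V' - V'| <= rho by rewrite subrr normr0.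
pose f := imex_map P Q0 R0 R F0 F1 h w.
have [|x y xV yV|x xV xE] := @fixed_point_ball K 'M[K]_(s, m) f V' rho rho0.
- move=> x xV.
  have := imex_map_lipschitz P Q0 R0 R L0_ge0 lip0 L1_ge0 lip1 h0 wD VD
    (fun i => ballD x i xV) (fun i => ballD V' i V'V').
  rewrite -/f; set g := imex_map _ _ _ _ _ _ _ V V' in Vd *.
  move=> fg.
  have -> : f x - V' = (f x - g - P *m (w - V)) + P *m (w - V) - (V' - g).
    by rewrite subrK opprB addrA subrK.
  rewrite (le_trans (ler_normB _ _))// (le_trans _ small)// lerD//.
  rewrite (le_trans (ler_normD _ _))// lerD//; last exact: mx_norm_mul.
  by rewrite (le_trans fg)// ler_wpM2l ?lerD2l// mulr_ge0.
- have := imex_map_lipschitz P Q0 R0 R L0_ge0 lip0 L1_ge0 lip1 h0 wD wD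
    (fun i => ballD x i xV) (fun i => ballD y i yV).
  rewrite -/f subrr mulmx0 subr0 normr0 add0r => /le_trans; apply.
  by rewrite ler_wpM2r.
by exists x; split=> [|i]; [exact: xE|exact: ballD].
Qed.

Theorem theorem2p1 (K : realType) (s m : nat)
  (c : 'cV[K]_s) (P R S2 : 'M[K]_s)
  (s_gt0 : (0 < s)%N)
  (c_distinct : forall i j : 'I_s, c i 0 = c j 0 -> i = j)
  (c_last : forall i : 'I_s, i.+1 = s -> c i 0 = 1)
  (R_lower : is_trig_mx R)
  (P_stable : zero_stable P)
  (stage_order_s : has_stage_order c P R s)
  (S2_strict : strictly_lower S2)
  (F0 F1 : 'rV[K]_m -> 'rV[K]_m) (D : set 'rV[K]_m)
  (a b : K) (ab : a < b) (ab0 : 0 \in `[a, b])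
  (u0 : 'rV[K]_m) (u : K -> 'rV[K]_m)
  (u_sol : nonstiff_solution F0 F1 D s a b u0 u)
  (w0 : K -> 'M[K]_(s, m))
  (w0_start : forall i : 'I_s,
     (fun h : K => row i (w0 h) - u (stage_time c h 0 i))
       =O_ (0^'+) (fun h : K => h ^+ s)) :
  imex_convergent c P (Qhat c R S2) (Rhat R S2) R F0 F1 D a b u w0 s.
Proof.
case: s s_gt0 c P R S2 c_distinct c_last {R_lower} P_stable stage_order_s
  {S2_strict} u_sol w0 w0_start => // s _ c P R S2 c_inj c_last P_stable so sol w0 w0O.
have c_max : c ord_max 0 = 1 by exact: c_last.
have [lip0 lip1 uD _ [[g [g0 gc _]] _]] := sol.
have [L0 L0_ge0 leL0] := lipschitz_constant lip0.
have [L1 L1_ge0 leL1] := lipschitz_constant lip1.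
have uc : {within `[a, b], continuous u} by rewrite -g0; exact: gc.
have [rho rho0 rhoD] := tube uc uD.
have [MP MP0 PM] := zero_stable_power_bounded P_stable.
have [Cd Cd0 leCd] := imex_consistency S2 c_inj c_max so ab sol.
have [C0 C0_ge0 w0le] := starting_error w0O.
set Q0 := Qhat c R S2 in leCd *; set R0 := Rhat R S2 in leCd *.
pose B := imex_lip Q0 R0 R L0 L1.
have B0 : 0 <= B by rewrite mulr_ge0// !addr_ge0// mulr_ge0.
pose Q := s.+1%:R * MP; have Q_ge0 : 0 <= Q by rewrite mulr_ge0.
have b0 : 0 <= b by move: ab0; rewrite in_itv => /andP[].
(* The bound of [imex_run_error], with [N * h <= b] because the last stage of
   step [N] is evaluated at the time [(N + 1) * h]. *)
pose C := 2 * Q * (C0 + b * Cd) * expR (4 * Q * B * b).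
have C_ge0 : 0 <= C by rewrite !mulr_ge0 ?expR_ge0// addr_ge0// mulr_ge0.
exists C; near=> h => N tN.
have h0 : 0 < h by near: h; exact: nbhs_right_gt.
have h_ge0 := ltW h0.
have h1 : h <= 1 by near: h; exact: nbhs_right_le.
have half0 : 0 < 1 / 2 :> K by rewrite divr_gt0.
have hQB : h * (Q * B) <= 1 / 2 by near: h; apply: near0_mul_le => //; exact: mulr_ge0.
have hB : h * B <= 1 / 2 by near: h; exact: near0_mul_le.
have hC0 : h * C0 <= rho by near: h; exact: near0_mul_le.
have hrho : h * (B * (C + rho) + s.+1%:R * `|P| * C + Cd) <= rho.
  near: h; apply: near0_mul_le => //.
  have Crho : 0 <= C + rho by rewrite addr_ge0// ltW.
  by apply: addr_ge0 => //; apply: addr_ge0; apply: mulr_ge0.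
have w0h : forall i, `|row i (w0 h) - u (stage_time c h 0 i)| <= C0 * h ^+ s.+1.
  by near: h.
have hs : h ^+ s.+1 <= h by rewrite exprS ler_piMr// exprn_ile1.
have hs0 : 0 <= h ^+ s.+1 by exact: exprn_ge0.
pose U := exact_stages u c h.
have UD n i : (n <= N)%N -> D (row i (U n)).
  by move=> nN; apply: nbhs_singleton; rewrite row_exact_stages; apply: uD; exact: tN.
have d0 : 0 <= Cd * h ^+ s.+2 by rewrite mulr_ge0// exprn_ge0.
have Ud n : (n < N)%N ->
    `|U n.+1 - imex_map P Q0 R0 R F0 F1 h (U n) (U n.+1)| <= Cd * h ^+ s.+2.
  by move=> nN; apply: leCd => // i; apply: tN => //; exact: ltnW.
have e0 : `|w0 h - U 0%N| <= C0 * h ^+ s.+1.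
  apply: mx_norm_le_rows => [|i]; first exact: mulr_ge0.
  by rewrite linearB /= row_exact_stages.
have Nh : N%:R * h <= b.
  have := tN N ord_max (leqnn N); rewrite in_itv /= /stage_time c_max mul1r.
  by move=> /andP[_]; apply: le_trans; rewrite lerDl.
have err N' w : (N' <= N)%N -> imex_run P Q0 R0 R F0 F1 D h N' (w0 h) w ->
    forall n, (n <= N')%N -> `|w n - U n| <= C * h ^+ s.+1.
  move=> N'N run n nN'.
  have N'h : N'%:R * h <= b by rewrite (le_trans _ Nh)// ler_wpM2r// ler_nat.
  have := imex_run_error L0_ge0 leL0 L1_ge0 leL1 MP0 PM h_ge0 d0 _ _ _ run nN'.
  rewrite -/B -/Q => /(_ U); rewrite mulrCA => /(_ hQB).
  move=> /(_ (fun k i kN' => UD k i (leq_trans kN' N'N))).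
  move=> /(_ (fun k kN' => Ud k (leq_trans kN' N'N))) /le_trans; apply.
  rewrite /C [leRHS]mulrAC ler_pM ?expR_ge0//.
  + by rewrite mulr_ge0 ?mulr_ge0// addr_ge0// mulr_ge0.
  + rewrite -[leRHS]mulrA ler_wpM2l ?mulr_ge0// mulrDl lerD//.
    rewrite (exprS h s.+1) -(mulrA b) (_ : _ * _ = N'%:R * h * (Cd * h ^+ s.+1)).
      by rewrite ler_wpM2r// mulr_ge0.
    by ring.
  + by rewrite ler_expR ler_wpM2l//; apply: mulr_ge0 => //; exact: mulr_ge0.
split; last first.
  move=> w run n i nN; rewrite -row_exact_stages -linearB.
  by rewrite (le_trans (row_le_mx_norm _ _))// (err N).
have UrhoD n i x : (n <= N)%N -> `|x - row i (U n)| <= rho -> D x.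
  by move=> nN; rewrite row_exact_stages; apply: rhoD; exact: tN.
suff ex n : (n <= N)%N -> exists w, imex_run P Q0 R0 R F0 F1 D h n (w0 h) w.
  exact: ex.
(* A run extends by one step because the error bound, applied to it, keeps it
   close to the exact solution. *)
elim: n => [_|n IH nN].
  exists (fun=> w0 h); split=> // [[]//|n i _].
  apply: (UrhoD 0%N i) => //; rewrite row_exact_stages (le_trans (w0h i))//.
  by rewrite (le_trans _ hC0)// mulrC ler_wpM2r.
have [w run] := IH (ltnW nN); have [w00 wstep wD] := run.
have en := err n w (ltnW nN) run n (leqnn n).
have [|||x [xstep xD]] := @imex_step_exists K s.+1 m P Q0 R0 R F0 F1 D L0 L1 h
  (Cd * h ^+ s.+2) rho (w n) (U n) (U n.+1) L0_ge0 leL0 L1_ge0 leL1 h_ge0 (ltW rho0) hB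
  (fun i => wD n i (leqnn n)) (fun i => UD n i (ltnW nN)).
- by move=> i x; exact: UrhoD.
- exact: Ud.
- have en_h : `|w n - U n| <= C * h by rewrite (le_trans en)// ler_wpM2l.
  have en_1 : `|w n - U n| <= C by rewrite (le_trans en_h)// ler_piMr.
  have le1 : h * B * (`|w n - U n| + rho) <= h * B * (C + rho).
    by rewrite ler_wpM2l ?lerD2r// mulr_ge0.
  have le2 : s.+1%:R * `|P| * `|w n - U n| <= s.+1%:R * `|P| * (C * h).
    by rewrite ler_wpM2l// mulr_ge0.
  have le3 : Cd * h ^+ s.+2 <= Cd * h.
    by rewrite ler_wpM2l// exprS ler_piMr// exprn_ile1.
  by move: le1 le2 le3 hrho; rewrite -/B; lra.
exists (fun k => if k == n.+1 then x else w k); split=> //.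
- move=> k /andP[k0]; rewrite leq_eqVlt => /orP[/eqP->|kn].
    by rewrite eqxx /= ltn_eqF.
  rewrite [k == _]ltn_eqF// [k.-1 == _]ltn_eqF//; last first.
    by rewrite (leq_ltn_trans (leq_pred _)).
  by apply: wstep; rewrite k0.
- move=> k i; rewrite leq_eqVlt => /orP[/eqP->|kn]; first by rewrite eqxx.
  by rewrite ltn_eqF//; exact: wD.
Unshelve. all: by end_near. Qed.
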